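(* Let $A=[a_{ij}]_{i,j=1,\dots,N-1}$ be the matrix representation of the discretized fractional Laplacian defined in the context. Then: 1) $A$ is a strictly diagonally dominant $M$-matrix; 2) $A$ is symmetric positive definite; 3) the absolute values of the entries $a_{ij}$ decay away from the diagonal, i.e. $a_{11}>|a_{12}|>\cdots>|a_{1,N-1}|$, and $\lim_{N\to\infty}|a_{1,N-1}|=0$ (with $\alpha,\mu,l$ fixed).
   Context: Let $\alpha\in(0,2)$, $\mu\in(\alpha,2]$, $\nu=\mu-\alpha$, and let $\kappa_\mu=1$ if $\mu\in(\alpha,2)$ and $\kappa_\mu=2$ if $\mu=2$. Let $l>0$, let $N$ be a positive integer, $h=2l/N$, and $$c_{1,\alpha}=\frac{2^{\alpha-1}\alpha\,\Gamma(\frac{\alpha+1}{2})}{\sqrt{\pi}\,\Gamma(1-\alpha/2)},\qquad C^h_{\alpha,\mu}=\frac{c_{1,\alpha}}{\nu h^\alpha}>0 .$$ The matrix $A=[a_{ij}]_{i,j=1,\dots,N-1}$ (a real symmetric Toeplitz matrix of order $N-1$) is defined by $$a_{ij}=C^h_{\alpha,\mu}\begin{cases}\sum\limits_{\ell=2}^{N-1}\frac{(\ell+1)^\nu-(\ell-1)^\nu}{\ell^\mu}+\frac{N^\nu-(N-1)^\nu}{N^\mu}+(2^\nu+\kappa_\mu-1)+\frac{2\nu}{\alpha N^\alpha},& j=i,\\[2mm] -\frac{2^\nu+\kappa_\mu-1}{2},& j=i\pm1,\\[1mm] -\frac{(|j-i|+1)^\nu-(|j-i|-1)^\nu}{2|j-i|^\mu},&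 j\neq i,\,i\pm1.\end{cases}$$ *)

(* Defs.v *)
From mathcomp Require Import all_boot all_order all_algebra sesquilinear.
From mathcomp Require Import all_classical all_reals all_analysis.
Import Order.TTheory GRing.Theory Num.Theory.
Import numFieldNormedType.Exports.

Set Implicit Arguments.
Unset Strict Implicit.
Unset Printing Implicit Defensive.

Local Open Scope classical_set_scope.
Local Open Scope ring_scope.

Definition strictly_diag_dominant (R : numDomainType) (n : nat)
    (A : 'M[R]_n) : Prop :=
  forall i : 'I_n, \sum_(j < n | j != i) `|A i j| < `|A i i|.

(* "M-matrix" in the sense of nonsingular M-matrix: nonpositive off-diagonal
   entries, invertible, entrywise nonnegative inverse. *)
Definition M_matrix (R : numFieldType) (n : nat) (A : 'M[R]_n) : Prop :=
  [/\ forall i j : 'I_n, i != j -> A i j <= 0,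
      A \in unitmx
    & forall i j : 'I_n, 0 <= invmx A i j].

Definition sym_pos_def (R : realFieldType) (n : nat) (A : 'M[R]_n) : Prop :=
  A \is symmetricmx /\
  forall x : 'cV[R]_n, x != 0 -> 0 < (x^T *m A *m x) ord0 ord0.

Definition Gamma (R : realType) (s : R) : R :=
  Rintegral (@lebesgue_measure R) `]0, +oo[
    (fun t : R => t `^ (s - 1) * expR (- t)).

Section FractionalLaplacian.
Variables (R : realType) (alpha mu l : R) (N : nat).

Let nu : R := mu - alpha.

Definition kappa : R := if mu == 2 then 2 else 1.

Definition c1 : R :=
  2 `^ (alpha - 1) * alpha * Gamma ((alpha + 1) / 2)
  / (Num.sqrt pi * Gamma (1 - alpha / 2)).

Definition Ch : R :=
  let h := 2 * l / N%:R in c1 / (nu * h `^ alpha).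

Definition diag_entry : R :=
  \sum_(2 <= k < N) (k.+1%:R `^ nu - k.-1%:R `^ nu) / k%:R `^ mu
  + (N%:R `^ nu - N.-1%:R `^ nu) / N%:R `^ mu
  + (2 `^ nu + kappa - 1)
  + 2 * nu / (alpha * N%:R `^ alpha).

Definition offdiag_entry (d : nat) : R :=
  if d == 1%N then - ((2 `^ nu + kappa - 1) / 2)
  else - ((d.+1%:R `^ nu - d.-1%:R `^ nu) / (2 * d%:R `^ mu)).

(* Row and column indices start at 0; the entries depend only on |j - i|. *)
Definition frac_lap_mx : 'M[R]_(N.-1) :=
  \matrix_(i, j)
    (Ch * (if j == i then diag_entry
           else offdiag_entry `|(j : nat)%:Z - (i : nat)%:Z|%N)).

End FractionalLaplacian.

(* Main.v *)
Require Import Defs.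
From mathcomp Require Import all_boot all_order all_algebra.
From mathcomp Require Import sesquilinear lra.
From mathcomp Require Import all_classical all_reals all_analysis.
From mathcomp Require Import measurable_realfun.
Import Order.TTheory GRing.Theory Num.Theory.
Import numFieldNormedType.Exports.

Local Open Scope classical_set_scope.
Local Open Scope ring_scope.

(** Everything rests on a rewriting of the entries. With nu = mu - alpha and
    u = 1/d,

      ((d+1)^nu - (d-1)^nu) / d^mu  =  u^alpha ((1+u)^nu - (1-u)^nu),

    and for u in (0, 1] both factors on the right are positive and strictly
    increasing in u ([difference_quotientE], [spread_lt]). Hence the
    off-diagonal entries are negative and their absolute values strictly
    decrease with the distance d to the diagonal; the special value at d = 1
    respects this because it is at least the general one
    ([coupling_decreasing]).

    The diagonal entry contains the sum of these weights over all distances up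
    to N - 1, plus a positive tail, whereas each row meets every distance at
    most twice, with weight one half ([toeplitz_row_sum_le],
    [sum_coupling_lt_diag_entry]). So the matrix is strictly diagonally
    dominant with positive diagonal, provided that the common factor Ch is
    positive. The M-matrix property then comes from a maximum principle
    ([sdd_inverse_monotone], [sdd_M_matrix]), and positive definiteness from
    the inequality |2 x_i x_j| <= x_i^2 + x_j^2 ([sdd_sym_pos_def]).

    Positivity of Ch amounts to that of two values of the Gamma integral, that
    is, to its convergence at 0 and at infinity ([Gamma_gt0]).

    For the corner entry, the growth of h^(-alpha) in Ch is compensated by the
    factor u^alpha, and (1+u)^nu - (1-u)^nu tends to 0 with u
    ([frac_lap_mx_corner_le], [spread_cvg0]). *)

(** * Strictly diagonally dominant matrices *)

(** Discrete maximum principle. At a coordinate m where x is minimal, if x_m < 0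
    then replacing every off-diagonal x_j by x_m can only increase (A x)_m,
    because the off-diagonal entries are nonpositive. What results is x_m times
    the positive excess of the diagonal over the rest of row m, hence is
    negative. *)
Lemma sdd_inverse_monotone (R : realFieldType) (n : nat) (A : 'M[R]_n)
    (x : 'cV[R]_n) :
  strictly_diag_dominant A -> (forall i, 0 < A i i) ->
  (forall i j, i != j -> A i j <= 0) ->
  (forall i, 0 <= (A *m x) i ord0) -> forall i, 0 <= x i ord0.
Proof.
move=> dd dpos offd Ax0 i0.
have [m _ minm] := @arg_minP _ R _ i0 xpredT (fun i => x i ord0) erefl.
apply: le_trans (minm i0 erefl); rewrite leNgt; apply/negP => xm_lt0.
have : (A *m x) m ord0 < 0; last by rewrite ltNge Ax0.
rewrite mxE (bigD1 m) //=.
have le_row : \sum_(j < n | j != m) A m j * x j ord0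
    <= - ((\sum_(j < n | j != m) `|A m j|) * x m ord0).
  rewrite mulr_suml -sumrN; apply: ler_sum => j jm.
  have Amj : A m j <= 0 by apply: offd; rewrite eq_sym.
  by rewrite ler0_norm // mulNr opprK ler_wnM2l // minm.
apply: le_lt_trans (lerD (lexx _) le_row) _.
by rewrite -mulrBl pmulr_rlt0 // subr_gt0 -[A m m]gtr0_norm.
Qed.

(** Both remaining parts of the M-matrix property follow from the maximum
    principle: applied to x and -x it makes the kernel trivial, and applied to
    the columns of the inverse, whose images are the unit vectors, it gives
    their nonnegativity. *)
Lemma sdd_M_matrix (R : realFieldType) (n : nat) (A : 'M[R]_n) :
  strictly_diag_dominant A -> (forall i, 0 < A i i) ->
  (forall i j, i != j -> A i j <= 0) -> M_matrix A.
Proof.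
move=> dd dpos offd.
have mono x := @sdd_inverse_monotone R n A x dd dpos offd.
have ker0 (x : 'cV[R]_n) : A *m x = 0 -> x = 0.
  move=> Ax0; apply/colP => i; rewrite mxE; apply/eqP; rewrite eq_le.
  apply/andP; split; last by apply: mono => j; rewrite Ax0 mxE.
  rewrite -oppr_ge0; have := mono (- x) _ i; rewrite mxE; apply=> j.
  by rewrite mulmxN Ax0 oppr0 mxE.
have Aunit : A \in unitmx.
  rewrite -unitmx_tr -row_free_unit; apply/inj_row_free => v vA0.
  apply: trmx_inj; rewrite trmx0; apply: ker0.
  by apply: trmx_inj; rewrite trmx_mul trmxK vA0 trmx0.
split=> // i j; have := mono (col j (invmx A)) _ i; rewrite mxE; apply=> k.
by rewrite colE mulmxA mulmxV // mul1mx mxE ler0n.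
Qed.

(** Gershgorin in quadratic form: by |2 x_i x_j| <= x_i^2 + x_j^2 and symmetry,
    the form dominates the diagonal one whose coefficients are the dominance
    gaps r_i. *)
Lemma sdd_sym_pos_def (R : realFieldType) (n : nat) (A : 'M[R]_n) :
  strictly_diag_dominant A -> (forall i, 0 < A i i) ->
  (forall i j, A i j = A j i) -> sym_pos_def A.
Proof.
move=> dd dpos symA; split.
  apply/is_hermitianmxP; rewrite expr0 scale1r; apply/matrixP => i j.
  by rewrite !mxE symA.
move=> x x_neq0.
pose r i := A i i - \sum_(j < n | j != i) `|A i j|.
have r_gt0 i : 0 < r i by rewrite subr_gt0 -[ltRHS]gtr0_norm.
have -> : (x^T *m A *m x) ord0 ord0
    = \sum_i \sum_j A i j * x i ord0 * x j ord0.
  rewrite -mulmxA mxE; apply: eq_bigr => i _; rewrite !mxE mulr_sumr.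
  by apply: eq_bigr => j _; rewrite mulrCA mulrA.
have [i xi_neq0] : exists i, x i ord0 != 0.
  apply/existsP; apply: contra_neqT x_neq0 => /existsPn x0.
  by apply/colP => i; rewrite mxE; apply/eqP/negPn/x0.
apply: (@lt_le_trans _ _ (\sum_i r i * x i ord0 ^+ 2)).
  rewrite (bigD1 i) //= ltr_wpDr //.
    by apply: sumr_ge0 => j _; rewrite mulr_ge0 ?sqr_ge0 // ltW.
  by rewrite mulr_gt0 // lt0r sqrf_eq0 xi_neq0 sqr_ge0.
pose S := \sum_i \sum_(j < n | j != i) `|A i j| * x i ord0 ^+ 2.
(* Symmetry of A lets the two halves of x_i^2 + x_j^2 trade roles. *)
have S_sym : \sum_i \sum_(j < n | j != i) `|A i j| * x j ord0 ^+ 2 = S.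
  rewrite (exchange_big_dep xpredT) //=; apply: eq_bigr => i1 _.
  by apply: eq_big => [j|j _]; rewrite 1?eq_sym 1?symA.
have -> : \sum_i r i * x i ord0 ^+ 2 = \sum_i A i i * x i ord0 ^+ 2
    - \sum_i \sum_(j < n | j != i)
        (`|A i j| * x i ord0 ^+ 2 + `|A i j| * x j ord0 ^+ 2) / 2.
  have -> : \sum_i \sum_(j < n | j != i)
      (`|A i j| * x i ord0 ^+ 2 + `|A i j| * x j ord0 ^+ 2) / 2 = S.
    under eq_bigr do rewrite -mulr_suml big_split /=.
    rewrite -mulr_suml big_split /= S_sym -/S; lra.
  rewrite -sumrB; apply: eq_bigr => i1 _.
  by rewrite mulrBl mulr_suml.
rewrite -sumrB; apply: ler_sum => i1 _.
rewrite [leRHS](bigD1 i1) //= expr2 mulrA lerD2l -sumrN.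
apply: ler_sum => j _.
rewrite -mulrDr -mulrA -[leRHS]opprK lerN2 -mulrN -mulrA.
apply: le_trans (ler_norm _) _; rewrite normrM.
apply: ler_wpM2l => //; rewrite ler_norml.
(* Both signs of x_i x_j are covered by the squares of x_i - x_j, x_i + x_j. *)
have := sqr_ge0 (x i1 ord0 - x j ord0); have := sqr_ge0 (x i1 ord0 + x j ord0).
rewrite !expr2; lra.
Qed.

(** * Positivity of the Gamma integral *)

Definition gamma_density {R : realType} (s t : R) : R :=
  t `^ (s - 1) * expR (- t).

Lemma gamma_density_ge0 (R : realType) (s t : R) : 0 <= gamma_density s t.
Proof. by rewrite mulr_ge0 ?powR_ge0 ?expR_ge0. Qed.

Lemma measurable_gamma_density (R : realType) (s : R) (D : set R) :
  measurable_fun D (fun t => (gamma_density s t)%:E).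
Proof.
apply: measurable_funTS; apply/measurable_EFinP; apply: measurable_funM.
  exact: measurable_powR.
by apply: (measurableT_comp (@measurable_expR R)); exact: oppr_measurable.
Qed.

(** The bound is uniform in e, hence survives e -> 0, the only place where the
    integrand may be discontinuous; away from 0 the primitive t^s / s gives the
    value of the integral. *)
Lemma integral_powR_le (R : realType) (s e : R) : 0 < s -> 0 < e -> e < 1 ->
  (\int[lebesgue_measure]_(t in `[e, 1%R]) (t `^ (s - 1)%R)%:E <= (s^-1)%:E)%E.
Proof.
move=> s0 e0 e1.
have der (r x : R) : e <= x -> derivable (fun y : R => y `^ r) x 1.
  by move=> ex; apply: derivable_powR; rewrite in_itv /= andbT (lt_le_trans e0).
have cont (r x : R) : e <= x -> {for x, continuous (fun y : R => y `^ r)}.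
  by move=> ex; apply/differentiable_continuous/derivable1_diffP/der.
rewrite (@continuous_FTC2 _ _ (fun x => s^-1 * x `^ s)) //.
- rewrite -EFinB lee_fin powR1 mulr1 gerBl.
  by rewrite mulr_ge0 ?powR_ge0 ?invr_ge0 ?ltW.
- apply: continuous_in_subspaceT => x; rewrite inE /= in_itv /= => /andP[ex _].
  exact: cont.
- split.
  + move=> x; rewrite in_itv /= => /andP[/ltW ex _].
    by apply: derivableM => //; exact: der.
  + by apply: cvg_at_right_filter; apply: cvgMl_tmp; exact: cont.
  + by apply: cvg_at_left_filter; apply: cvgMl_tmp; apply: cont; exact: ltW.
- move=> x; rewrite in_itv /= => /andP[/ltW ex _].
  rewrite derive1Ml; last exact: der.
  rewrite powR_derive1 ?mulKf ?gt_eqF //.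
  by rewrite in_itv /= andbT (lt_le_trans e0).
Qed.

Lemma gamma_density_int01 (R : realType) (s : R) : 0 < s ->
  (\int[lebesgue_measure]_(t in `]0%R, 1%R]) (gamma_density s t)%:E < +oo)%E.
Proof.
move=> s0; apply: (@le_lt_trans _ _ (s^-1)%:E); last exact: ltry.
(* The left ends start at 1/2, as the intervals must not degenerate to {1}. *)
pose F n : set R := `[n.+2%:R^-1, 1]%classic.
have -> : `]0%R, 1%R]%classic = \bigcup_n F n.
  apply/seteqP; split=> [t|t [n _]]; rewrite /F /= !in_itv /= => /andP[t0 t1].
    have [n _ nt] := @near_infty_natSinv_lt R (PosNum t0).
    exists n => //=; rewrite in_itv /= t1 andbT.
    by apply: ltW; apply: (nt n.+1); rewrite /= leqnSn.
  by rewrite t1 andbT (lt_le_trans _ t0) // invr_gt0.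
have cvgF : (\int[lebesgue_measure]_(t in F i) (gamma_density s t)%:E
    @[i --> \oo] -->
    \int[lebesgue_measure]_(t in \bigcup_n F n) (gamma_density s t)%:E)%E.
  apply: ge0_nondecreasing_set_cvg_integral.
  - apply/nondecreasing_seqP => n; apply/subsetPset; apply: subset_itvr.
    by rewrite bnd_simp lef_pV2 ?posrE // ler_nat.
  - by move=> i; exact: measurable_itv.
  - by move=> i; exact: measurable_gamma_density.
  - by move=> i x _; rewrite lee_fin gamma_density_ge0.
rewrite -(cvg_lim _ cvgF) //; apply: lime_le.
  by apply/cvg_ex; eexists; exact: cvgF.
near=> n; apply: le_trans (@integral_powR_le R s n.+2%:R^-1 s0 _ _).
- apply: ge0_le_integral => //=.
  + exact: measurable_itv.
  + by move=> x _; rewrite lee_fin gamma_density_ge0.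
  + exact: measurable_gamma_density.
  + by apply: measurable_funTS; apply/measurable_EFinP; exact: measurable_powR.
  + move=> x; rewrite /F /= in_itv /= => /andP[x0 _].
    rewrite lee_fin ler_piMr ?powR_ge0 // -expR0 ler_expR oppr_le0.
    by apply: le_trans x0; rewrite invr_ge0.
- by rewrite invr_gt0.
- by rewrite invf_lt1 // ltr1n.
Unshelve. all: by end_near. Qed.

(** For t > 1 and s <= 2 the integrand is at most t e^(-t), and
    t/2 <= e^(t/2) bounds this by 2 e^(-t/2), which is 4 times the density of
    the exponential law of rate 1/2. *)
Lemma gamma_density_int1y (R : realType) (s : R) : s <= 2 ->
  (\int[lebesgue_measure]_(t in `]1%R, +oo[) (gamma_density s t)%:E < +oo)%E.
Proof.
move=> s2.
have mE (D : set R) :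
    measurable_fun D (fun t => (@exponential_pdf R 2^-1 t)%:E).
  apply: measurable_funTS; apply/measurable_EFinP.
  exact: measurable_exponential_pdf.
have pdf0 x : 0 <= @exponential_pdf R 2^-1 x.
  by apply: exponential_pdf_ge0; rewrite invr_ge0.
apply: (@le_lt_trans _ _ (4%:E * \int[lebesgue_measure]_(t in `]1%R, +oo[)
  (@exponential_pdf R 2^-1 t)%:E)%E).
  rewrite -ge0_integralZl //; last 2 first.
  - exact: mE.
  - by move=> x _; rewrite lee_fin.
  apply: ge0_le_integral => //=.
  - by move=> x _; rewrite lee_fin gamma_density_ge0.
  - exact: measurable_gamma_density.
  - by apply: measurable_funeM; exact: mE.
  move=> x; rewrite in_itv /= andbT => x1.
  rewrite -EFinM lee_fin exponential_pdfE; last first.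
    by rewrite ltW // (lt_trans _ x1).
  apply: (@le_trans _ _ (x * expR (- x))).
    apply: ler_wpM2r; first exact: expR_ge0.
    have x0 : 0 <= x by rewrite ltW // (lt_trans _ x1).
    by rewrite -[leRHS]powRr1 // ler_powR // ?(ltW x1) //; lra.
  have -> : - x = - 2^-1 * x + (- 2^-1 * x) by lra.
  rewrite expRD mulrA [4 * _]mulrA ler_wpM2r ?expR_ge0 // mulNr expRN.
  rewrite ler_pdivrMr ?expR_gt0 //.
  have := expR_ge1Dx (2^-1 * x); lra.
rewrite lte_mul_pinfty //.
apply: (@le_lt_trans _ _ (\int[lebesgue_measure]_t
  (@exponential_pdf R 2^-1 t)%:E)%E).
  apply: ge0_subset_integral => //=; first exact: mE.
  by move=> x _; rewrite lee_fin.
by rewrite integral_exponential_pdf // ?ltry // invr_gt0.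
Qed.

(** Gamma is a real-valued integral, which by convention is 0 when the
    integral diverges; positivity therefore needs convergence as well as a
    positive lower bound, here taken on [1, 2]. *)
Lemma Gamma_gt0 (R : realType) (s : R) : 0 < s -> s <= 2 -> 0 < Gamma s.
Proof.
move=> s0 s2; rewrite /Gamma /Rintegral.
have splitU : `]0, +oo[%classic = `]0, 1] `|` `]1, +oo[ :> set R.
  by rewrite -itv_bndbnd_setU // bnd_simp.
apply: fine_gt0; apply/andP; split; last first.
  rewrite splitU ge0_integral_setU //=; last 3 first.
  - exact: measurable_gamma_density.
  - by move=> x _; rewrite lee_fin gamma_density_ge0.
  - apply/disj_setPS => x [] /=; rewrite !in_itv /= andbT => /andP[_ x1].
    by rewrite ltNge x1.
  by rewrite lte_add_pinfty // ?gamma_density_int01 // gamma_density_int1y.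
apply: (@lt_le_trans _ _ (\int[lebesgue_measure]_(t in `[1%R, 2%R])
  (gamma_density s t)%:E)%E); last first.
  apply: ge0_subset_integral => //=.
  - exact: measurable_gamma_density.
  - by move=> x _; rewrite lee_fin gamma_density_ge0.
  - move=> x /=; rewrite !in_itv /= andbT => /andP[x1 _].
    by rewrite (lt_le_trans _ x1).
apply: (@lt_le_trans _ _ (\int[lebesgue_measure]_(t in `[1%R, 2%R])
  (cst (2^-1 * expR (- 2 : R))%:E t))%E).
  rewrite integral_cst //=.
  rewrite lebesgue_measure_itv /= lte_fin ltr1n /=.
  by rewrite -EFinB -EFinM lte_fin !mulr_gt0 ?invr_gt0 ?expR_gt0 //; lra.
apply: ge0_le_integral => //=.
- exact: measurable_gamma_density.
move=> x; rewrite in_itv /= => /andP[x1 x2]; rewrite lee_fin.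
have x0 : 0 < x by exact: lt_le_trans x1.
apply: ler_pM; rewrite ?expR_ge0 ?invr_ge0 // ?ler_expR ?lerN2 //.
apply: (@le_trans _ _ (x `^ (-1))).
  by rewrite powR_inv1 ?lef_pV2 ?posrE // ltW.
by apply: ler_powR => //; lra.
Qed.

(** * Row sums of Toeplitz matrices *)

(** Each distance d occurs at most twice in a row, once on either side of the
    diagonal, and never exceeds n - 1. *)
Lemma toeplitz_row_sum_le (R : realDomainType) (n : nat) (i : 'I_n)
    (w : nat -> R) : (forall d, (0 < d)%N -> 0 <= w d) ->
  \sum_(j < n | j != i) w `|(j : nat)%:Z - (i : nat)%:Z|%N
    <= 2 * \sum_(1 <= d < n) w d.
Proof.
move=> w_ge0; have i_lt_n := ltn_ord i.
(* The two sides of the diagonal give sums over d <= i and d < n - i. *)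
have prefix_le m : (m <= n)%N ->
    \sum_(1 <= d < m) w d <= \sum_(1 <= d < n) w d.
  move=> mn; have [m1|m1] := leqP m 1.
    by rewrite (big_geq m1) big_nat_cond sumr_ge0 // => d /andP[/andP[/w_ge0]].
  rewrite [leRHS](@big_cat_nat _ _ _ m) //= 1?ltnW // lerDl.
  rewrite big_nat_cond sumr_ge0 // => d /andP[/andP[md _] _].
  by rewrite w_ge0 // (leq_trans _ md) // ltnW.
rewrite -(@big_mkord _ _ _ n (fun j => j != i)
  (fun j => w `|j%:Z - (i : nat)%:Z|%N)).
rewrite (@big_cat_nat _ _ _ i) //= 1?ltnW // [X in _ + X]big_ltn_cond //.
rewrite eqxx /= mulr_natl mulr2n; apply: lerD.
  rewrite big_nat_rev /= add0n.
  apply: le_trans (prefix_le i.+1 i_lt_n).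
  rewrite big_add1 /= [leLHS]big_nat_cond [leRHS]big_nat_cond.
  rewrite le_eqVlt; apply/orP; left; apply/eqP; apply: eq_big => [d|d].
    case: (ltnP d i) => //= di.
    by rewrite neq_ltn ltn_subrL (leq_ltn_trans _ di).
  move=> /andP[/andP[_ di] _]; rewrite distnEr ?leq_subr //.
  by rewrite subKn.
apply: le_trans (prefix_le (n - i)%N (leq_subr i n)).
rewrite (@big_addn _ _ _ 1 n i).
rewrite le_eqVlt; apply/orP; left; apply/eqP.
rewrite [LHS]big_nat_cond [RHS]big_nat_cond; apply: eq_big => [d|d _].
  case: d => //= d; case: ltnP => //= _.
  by rewrite -{2}[i : nat]add0n eqn_add2r.
by rewrite distnEl ?leq_addl // addnK.
Qed.

(** * Off-diagonal decay of the couplings *)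

(** In terms of u = 1/d this is the part of the entry at distance d that
    remains after the factor u^alpha is taken out; both factors increase with
    u, which is how decay away from the diagonal becomes visible. *)
Definition spread {R : realType} (nu u : R) : R :=
  (1 + u) `^ nu - (1 - u) `^ nu.

Lemma spread_lt (R : realType) (nu u v : R) :
  0 < nu -> 0 <= u -> u < v -> v <= 1 -> spread nu u < spread nu v.
Proof.
move=> nu0 u0 uv v1; rewrite /spread ltrD // ?ltrN2.
  by apply: gt0_ltr_powR => //; rewrite ?nnegrE; lra.
by apply: gt0_ltr_powR => //; rewrite ?nnegrE; lra.
Qed.

Lemma spread_gt0 (R : realType) (nu u : R) :
  0 < nu -> 0 < u -> u <= 1 -> 0 < spread nu u.
Proof.
move=> nu0 u0 u1; have := @spread_lt R nu 0 u nu0 (lexx 0) u0 u1.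
by rewrite {1}/spread addr0 subr0 subrr.
Qed.

Lemma spread_cvg0 (R : realType) (nu : R) :
  spread nu u @[u --> (0 : R)] --> (0 : R).
Proof.
have powR_cont1 : {for 1, continuous (fun y : R => y `^ nu)}.
  apply/differentiable_continuous/derivable1_diffP.
  by apply: derivable_powR; rewrite in_itv /= andbT.
have cvg_powR1 (f : R -> R) : f u @[u --> (0 : R)] --> (1 : R) ->
    (f u) `^ nu @[u --> (0 : R)] --> 1 `^ nu.
  by move=> f1; exact: (continuous_cvg _ powR_cont1 f1).
have addr_cvg : 1 + u @[u --> (0 : R)] --> (1 + 0 : R).
  by apply: cvgD; [exact: cvg_cst|exact: cvg_id].
have subr_cvg : 1 - u @[u --> (0 : R)] --> (1 - 0 : R).
  by apply: cvgB; [exact: cvg_cst|exact: cvg_id].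
rewrite addr0 in addr_cvg; rewrite subr0 in subr_cvg.
have := cvgB (cvg_powR1 _ addr_cvg) (cvg_powR1 _ subr_cvg).
rewrite subrr => spread_cvg; exact: spread_cvg.
Qed.

(** Factor d^nu out of the difference and use nu - mu = - alpha. *)
Lemma difference_quotientE (R : realType) (alpha mu : R) (d : nat) :
  (0 < d)%N ->
  (d.+1%:R `^ (mu - alpha) - d.-1%:R `^ (mu - alpha)) / d%:R `^ mu
  = d%:R^-1 `^ alpha * spread (mu - alpha) d%:R^-1.
Proof.
move=> d0; have dR0 : 0 < d%:R :> R by rewrite ltr0n.
have dV1 : d%:R^-1 <= 1 :> R by rewrite invf_le1 // ler1n.
have -> : d.+1%:R = d%:R * (1 + d%:R^-1) :> R.
  by rewrite mulrDr mulr1 divff ?gt_eqF // -natr1.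
have -> : d.-1%:R = d%:R * (1 - d%:R^-1) :> R.
  by rewrite mulrBr mulr1 divff ?gt_eqF // -subn1 natrB.
have dVge0 : 0 <= d%:R^-1 :> R by rewrite invr_ge0.
rewrite !powRM ?subr_ge0 ?addr_ge0 //.
rewrite -mulrBr -/(spread _ _) mulrAC; congr (_ * _).
rewrite -powRB; last by rewrite (gt_eqF dR0) implybT.
rewrite -[d%:R^-1]powR_inv1 ?ltW // -powRrM; congr (_ `^ _); lra.
Qed.

(** Up to the factor - Ch / 2, the entry at distance d from the diagonal; the
    diagonal entry is chosen so as to exceed the sum of these numbers. *)
Definition coupling {R : realType} (alpha mu : R) (d : nat) : R :=
  if d == 1%N then 2 `^ (mu - alpha) + kappa mu - 1
  else (d.+1%:R `^ (mu - alpha) - d.-1%:R `^ (mu - alpha)) / d%:R `^ mu.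

Lemma offdiag_entryE (R : realType) (alpha mu : R) (d : nat) :
  offdiag_entry alpha mu d = - (coupling alpha mu d / 2).
Proof.
rewrite /offdiag_entry /coupling; case: eqP => // _.
by rewrite [2 * _]mulrC invfM mulrA.
Qed.

(** At d = 1 the special value 2^nu + kappa - 1 is at least the general formula
    2^nu, since kappa >= 1; so the first entry can only help monotonicity. *)
Lemma coupling_ge_quotient (R : realType) (alpha mu : R) (d : nat) :
  alpha < mu -> (0 < d)%N ->
  d%:R^-1 `^ alpha * spread (mu - alpha) d%:R^-1 <= coupling alpha mu d.
Proof.
move=> amu d0; rewrite -difference_quotientE // /coupling.
case: eqP => // ->; rewrite /= powR0 ?subr_eq0 ?gt_eqF // powR1 divr1 subr0.
by rewrite /kappa; case: ifP => _; lra.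
Qed.

Lemma coupling_gt0 (R : realType) (alpha mu : R) (d : nat) :
  alpha < mu -> (0 < d)%N -> 0 < coupling alpha mu d.
Proof.
move=> amu d0; apply: lt_le_trans (@coupling_ge_quotient R _ _ d amu d0).
have dR0 : 0 < d%:R^-1 :> R by rewrite invr_gt0 ltr0n.
by rewrite mulr_gt0 ?powR_gt0 ?spread_gt0 ?subr_gt0 // invf_le1 ?ler1n ?ltr0n.
Qed.

Lemma coupling_decreasing (R : realType) (alpha mu : R) (d : nat) :
  0 < alpha -> alpha < mu -> (0 < d)%N ->
  coupling alpha mu d.+1 < coupling alpha mu d.
Proof.
move=> a0 amu d0; apply: lt_le_trans (@coupling_ge_quotient R _ _ d amu d0).
rewrite /coupling eqSS (gtn_eqF d0) difference_quotientE //.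
have dV : d.+1%:R^-1 < d%:R^-1 :> R by rewrite ltf_pV2 ?posrE ?ltr0n // ltr_nat.
have dV0 : 0 < d.+1%:R^-1 :> R by rewrite invr_gt0.
have dV1 : d%:R^-1 <= 1 :> R by rewrite invf_le1 ?ler1n ?ltr0n.
apply: ltr_pM; rewrite ?powR_ge0 //.
- by apply: ltW; apply: spread_gt0; rewrite ?subr_gt0 // (le_trans (ltW dV)).
- by apply: gt0_ltr_powR; rewrite ?nnegrE // ltW // (lt_trans dV0).
- by apply: spread_lt; rewrite ?subr_gt0 // ltW.
Qed.

(** The diagonal entry contains all couplings up to distance N - 1, and the
    term 2 nu / (alpha N^alpha) makes the inequality strict. *)
Lemma sum_coupling_lt_diag_entry (R : realType) (alpha mu : R) (N : nat) :
  0 < alpha -> alpha < mu -> (1 < N)%N ->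
  \sum_(1 <= d < N.-1) coupling alpha mu d < diag_entry alpha mu N.
Proof.
move=> a0 amu N1; have nu0 : 0 < mu - alpha by rewrite subr_gt0.
have NR0 : 0 < N%:R :> R by rewrite ltr0n ltnW.
apply: (@le_lt_trans _ _ (\sum_(1 <= d < N) coupling alpha mu d)).
  rewrite -{2}(ltn_predK N1); have [->|N2] := posnP N.-1.
    by rewrite big_geq // big_geq.
  by rewrite big_nat_recr //= lerDl ltW // coupling_gt0.
rewrite big_ltn // {1}/coupling eqxx /diag_entry.
have -> : \sum_(2 <= d < N) coupling alpha mu d
   = \sum_(2 <= k < N) (k.+1%:R `^ (mu - alpha) - k.-1%:R `^ (mu - alpha))
       / k%:R `^ mu.
  by apply: eq_big_nat => -[|[|d]].
have b_ge0 : 0 <= (N%:R `^ (mu - alpha) - N.-1%:R `^ (mu - alpha)) / N%:R `^ mu.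
  rewrite divr_ge0 ?powR_ge0 // subr_ge0.
  by apply: ge0_ler_powR; rewrite ?nnegrE ?ler0n ?(ltW nu0) // ler_nat leq_pred.
have t_gt0 : 0 < 2 * (mu - alpha) / (alpha * N%:R `^ alpha).
  by rewrite divr_gt0 ?mulr_gt0 ?powR_gt0.
lra.
Qed.

(** * The discretized fractional Laplacian *)

Lemma c1_gt0 (R : realType) (alpha : R) :
  0 < alpha -> alpha < 2 -> 0 < c1 alpha.
Proof.
move=> a0 a2.
rewrite divr_gt0 ?mulr_gt0 ?powR_gt0 ?sqrtr_gt0 ?pi_gt0 //.
  by apply: Gamma_gt0; lra.
by apply: Gamma_gt0; lra.
Qed.

Lemma Ch_gt0 (R : realType) (alpha mu l : R) (N : nat) :
  0 < alpha -> alpha < 2 -> alpha < mu -> 0 < l -> (0 < N)%N ->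
  0 < Ch alpha mu l N.
Proof.
move=> a0 a2 amu l0 N0.
by rewrite divr_gt0 ?c1_gt0 // mulr_gt0 ?subr_gt0 // powR_gt0 // divr_gt0
  ?mulr_gt0 // ltr0n.
Qed.

Lemma frac_lap_mx_diag (R : realType) (alpha mu l : R) (N : nat) (i : 'I_N.-1) :
  frac_lap_mx alpha mu l N i i = Ch alpha mu l N * diag_entry alpha mu N.
Proof. by rewrite mxE eqxx. Qed.

Lemma frac_lap_mx_offdiag (R : realType) (alpha mu l : R) (N : nat)
    (i j : 'I_N.-1) : j != i ->
  frac_lap_mx alpha mu l N i j =
  - (Ch alpha mu l N / 2 * coupling alpha mu `|(j : nat)%:Z - (i : nat)%:Z|%N).
Proof.
by move=> ji; rewrite mxE (negbTE ji) offdiag_entryE mulrN mulrA mulrAC.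
Qed.

Lemma dist_ord_gt0 (n : nat) (i j : 'I_n) :
  j != i -> (0 < `|(j : nat)%:Z - (i : nat)%:Z|)%N.
Proof. by move=> ji; rewrite absz_gt0 subr_eq0 eqz_nat. Qed.

Lemma frac_lap_mx_norm (R : realType) (alpha mu l : R) (N : nat)
    (i j : 'I_N.-1) :
  0 < alpha -> alpha < 2 -> alpha < mu -> 0 < l -> (0 < N)%N -> j != i ->
  `|frac_lap_mx alpha mu l N i j| =
  Ch alpha mu l N / 2 * coupling alpha mu `|(j : nat)%:Z - (i : nat)%:Z|%N.
Proof.
move=> a0 a2 amu l0 N0 ji; rewrite frac_lap_mx_offdiag // normrN gtr0_norm //.
apply: mulr_gt0; last by rewrite coupling_gt0 ?dist_ord_gt0.
by apply: divr_gt0 => //; exact: Ch_gt0.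
Qed.

Lemma frac_lap_mx_sdd (R : realType) (alpha mu l : R) (N : nat) :
  0 < alpha -> alpha < 2 -> alpha < mu -> 0 < l -> (0 < N)%N ->
  strictly_diag_dominant (frac_lap_mx alpha mu l N)
  /\ forall i, 0 < frac_lap_mx alpha mu l N i i.
Proof.
move=> a0 a2 amu l0 N0; have C0 := @Ch_gt0 R alpha mu l N a0 a2 amu l0 N0.
have Aii_gt i : \sum_(j < N.-1 | j != i) `|frac_lap_mx alpha mu l N i j|
    < frac_lap_mx alpha mu l N i i.
  have N1 : (1 < N)%N by case: (N) i => [|[|n]] // [].
  under eq_bigr do rewrite frac_lap_mx_norm //.
  rewrite frac_lap_mx_diag -mulr_sumr -mulrA ltr_pM2l //.
  apply: le_lt_trans (@sum_coupling_lt_diag_entry R _ _ N a0 amu N1).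
  rewrite ler_pdivrMl //; apply: toeplitz_row_sum_le => d d0.
  by rewrite ltW // coupling_gt0.
have Aii_gt0 i : 0 < frac_lap_mx alpha mu l N i i.
  by apply: le_lt_trans (Aii_gt i); apply: sumr_ge0.
by split=> // i; rewrite gtr0_norm.
Qed.

(** The factor h^(-alpha) of Ch grows like the alpha-th power of the order of
    the matrix, but it is cancelled by the factor d^(-alpha) of the coupling at
    the corner distance d = n + 2, because 1/d <= h/l. What is left is the
    spread of 1/d, which vanishes in the limit. *)
Lemma frac_lap_mx_corner_le (R : realType) (alpha mu l : R) (n : nat) :
  0 < alpha -> alpha < 2 -> alpha < mu -> 0 < l ->
  `|frac_lap_mx alpha mu l n.+4 ord0 ord_max| <=
  c1 alpha / (mu - alpha) / 2 * l^-1 `^ alpha * spread (mu - alpha) n.+2%:R^-1.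
Proof.
move=> a0 a2 amu l0; have nu0 : 0 < mu - alpha by rewrite subr_gt0.
rewrite frac_lap_mx_norm //=.
rewrite addn0 /coupling /= difference_quotientE //.
rewrite mulrA ler_wpM2r //.
  by rewrite ltW // spread_gt0 // invf_le1 // ler1n.
have c1_pos := c1_gt0 R alpha a0 a2.
have h_gt0 : 0 < 2 * l / n.+4%:R by rewrite divr_gt0 ?mulr_gt0.
have h_ge : n.+2%:R^-1 <= 2 * l / n.+4%:R * l^-1.
  have -> : 2 * l / n.+4%:R * l^-1 = 2 / n.+4%:R :> R.
    by rewrite mulrAC mulfK // gt_eqF.
  rewrite -[n.+2%:R^-1]mul1r ler_pdivrMr // mulrAC ler_pdivlMr // mul1r.
  by rewrite -natrM ler_nat mul2n -addnn !addSn !addnS !ltnS leq_addr.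
rewrite /Ch; move: (c1 alpha) (2 * l / n.+4%:R) c1_pos h_gt0 h_ge.
move=> c h c_gt0 h_gt0 h_ge.
rewrite invfM -!mulrA ler_pM2l // ler_pM2l ?invr_gt0 //.
rewrite mulrCA ler_pM2l ?invr_gt0 //.
rewrite ler_pdivrMl ?powR_gt0 // -powRM ?(ltW h_gt0) ?invr_ge0 ?(ltW l0) //.
apply: ge0_ler_powR; rewrite ?nnegrE ?mulr_ge0 ?invr_ge0 ?ler0n //.
all: exact: ltW.
Qed.

Theorem proposition2p1 (R : realType) (alpha mu l : R)
    (halpha0 : 0 < alpha) (halpha2 : alpha < 2)
    (hmu : alpha < mu) (hmu2 : mu <= 2) (hl : 0 < l) :
  (forall N : nat, (0 < N)%N ->
    let A := frac_lap_mx alpha mu l N in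
    [/\ strictly_diag_dominant A /\ M_matrix A,
        sym_pos_def A,
        (forall i j : 'I_(N.-1), i = 0%N :> nat -> j = 1%N :> nat ->
           `|A i j| < A i i)
      & (forall i j k : 'I_(N.-1), i = 0%N :> nat -> (0 < j)%N ->
           k = j.+1 :> nat -> `|A i k| < `|A i j|)])
  /\ (fun N : nat => `|frac_lap_mx alpha mu l N.+2 ord0 ord_max|)
       @ \oo --> (0 : R).
Proof.
split=> [N N0 A|].
  have [dd dpos] := @frac_lap_mx_sdd R alpha mu l N halpha0 halpha2 hmu hl N0.
  have C2_gt0 : 0 < Ch alpha mu l N / 2 by apply: divr_gt0 => //; exact: Ch_gt0.
  split.
  - split=> //; apply: sdd_M_matrix => // i j ij.
    rewrite frac_lap_mx_offdiag 1?eq_sym // oppr_le0.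
    apply/ltW/mulr_gt0 => //; apply: coupling_gt0 => //.
    by rewrite dist_ord_gt0 // eq_sym.
  - apply: sdd_sym_pos_def => // i j.
    by rewrite !mxE eq_sym distnC.
  - move=> i j i0 j1; rewrite -[ltRHS]gtr0_norm //.
    apply: le_lt_trans (dd i); rewrite (bigD1 j) /= ?lerDl ?sumr_ge0 //.
    by rewrite -val_eqE /= i0 j1.
  - move=> i j k i0 j0 kj.
    rewrite !frac_lap_mx_norm -?val_eqE /= ?i0 ?kj -?lt0n // !subr0 /=.
    by rewrite ltr_pM2l // coupling_decreasing.
rewrite -cvg_shiftS -cvg_shiftS /=.
pose K := c1 alpha / (mu - alpha) / 2 * l^-1 `^ alpha.
apply: (@squeeze_cvgr _ _ _ _ (fun=> 0)
  (fun n : nat => K * spread (mu - alpha) n.+2%:R^-1)).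
- by near=> n; rewrite normr_ge0 frac_lap_mx_corner_le.
- exact: cvg_cst.
- rewrite -[X in _ --> X](mulr0 K); apply: cvgMl_tmp.
  apply: (cvg_comp _ _ _ (spread_cvg0 R (mu - alpha))).
  by have := @cvg_harmonic R; rewrite -cvg_shiftS.
Unshelve. all: by end_near. Qed.
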